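(* Fix $\gamma\ge0$, and consider the shifted form of drifting game V2 with $N$ chips and $T$ rounds, where $\delta\in[0,1)$ is determined by $\gamma=\delta^2T/2$. For any $T$ and any $\theta\in(0,\tfrac23)$, if the number of chips satisfies $N\ge T^{(\theta+2)/4}$, then for any player strategy there exists an adversary strategy $\mathcal A$ associated with the lower-bound potential $$\Lambda_L(\mathbf s,t)=\frac1N\sum_{i=1}^N f(s_i+\beta,t-\tau)-f(-\delta T+\beta,-\tau),\qquad \beta=\tau=\left\lceil\frac{\delta T+T^{\theta/2}}{1-\delta}\right\rceil(1-\delta)-\delta T,$$ such that $$\frac1N\sum_{i=1}^N L(s_{0,i})\ge\frac{2}{\sqrt\pi}\int_{\sqrt\gamma}^\infty e^{-x^2}\,dx-O(T^{-\theta/4}),$$ where $O(\cdot)$ is understood as $T\to\infty$ with an implied constant depending only on $\gamma$ and $\theta$. Moreover, in every round $t$ the strategy $\mathcal A$ takes $z_{t,i}=0$ when $$s_{t,i}\le-\left\lceil\frac{\delta T+T^{\theta/2}}{1-\delta}\right\rceil(1-\delta)$$ and takes $|z_{t,i}|=1-\delta$ otherwise.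
   Context: Shifted form of drifting game V2. There are $N$ chips with positions $\mathbf s_t=(s_{t,1},\dots,s_{t,N})$, and rounds $t=-T,-T+1,\dots,-1$; initially $s_{-T,i}=0$ for all $i$. In round $t$ the player announces a probability vector $\mathbf p_t=(p_{t,1},\dots,p_{t,N})$; then the adversary, knowing $\mathbf p_t$, chooses $\mathbf z_t=(z_{t,1},\dots,z_{t,N})$ with $z_{t,i}\in[-1-\delta,1-\delta]$ for all $i$ and $\sum_ip_{t,i}z_{t,i}\ge0$; the positions are updated by $s_{t+1,i}=s_{t,i}+z_{t,i}$. The player's final loss is $\frac1N\sum_{i=1}^NL(s_{0,i})$ with $L(s)=\mathbf 1_{\{s\le-\delta T\}}$. (This is equivalent, via $z_i\mapsto z_i-\delta$, to the game with moves in $[-1,1]$, constraint $\mathbf p\cdot\mathbf z\ge\delta$ and loss $\mathbf 1_{\{s\le0\}}$.) A player strategy chooses $\mathbf p_t$ from the history of play; an adversary strategy chooses an admissible $\mathbf z_t$ from the history of play and $\mathbf p_t$. The function $f$ is defined for $s\in\mathbb R$, $t<0$ by $f(s,t)=\tilde g(s+\delta T,t)$, where $\tilde g(s,t)=\frac{2}{\sqrt\pi}\int_{s/\sqrt{-2t}}^\infty e^{-x^2}\,dx$ for $s>0$ and $\tilde g(s,t)=1$ for $s\le0$. That the adversary strategy is associated with $\Lambda_L$ means that in each round the adversary, knowing $\mathbf s_t$ and $\mathbf p_t$, uses $\Lambda_L$ to choose an admissible $\mathbf z_t$ for which the increment $\Lambda_L(\mathbf s_t+\mathbf z_t,t+1)-\Lambda_L(\mathbf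 s_t,t)$ is bounded below by a small negative error, these errors summing over all rounds to $O(T^{-\theta/4})$ in absolute value. *)

(* Defs.v *)
From HB Require Import structures.
From mathcomp Require Import all_boot all_order all_algebra.
From mathcomp Require Import all_classical all_reals all_analysis.
Set Implicit Arguments.
Unset Strict Implicit.
Unset Printing Implicit Defensive.
Import Order.TTheory GRing.Theory Num.Theory.
Import numFieldNormedType.Exports.
Local Open Scope classical_set_scope.
Local Open Scope ring_scope.

(* Shifted form of drifting game V2, with moves in [-1-delta, 1-delta].       *)
(* Rounds are indexed by k = 0, .., T-1; round k takes place at the negative  *)
(* time t = k - T, so k = 0 is t = -T and the final positions are at k = T.   *)

Section Game.
Context {R : realType} {N : nat}.
Implicit Types (p z s : 'rV[R]_N).

Definition prob_vector p : Prop :=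
  (forall i, 0 <= p 0 i) /\ \sum_i p 0 i = 1.

Definition admissible (delta : R) p z : Prop :=
  (forall i, -1 - delta <= z 0 i <= 1 - delta) /\
  0 <= \sum_i p 0 i * z 0 i.

(* The past rounds (p, z), oldest first. *)
Definition history : Type := seq ('rV[R]_N * 'rV[R]_N).

Definition position (h : history) : 'rV[R]_N := \sum_(r <- h) r.2.

Definition player_strategy (P : history -> 'rV[R]_N) : Prop :=
  forall h, prob_vector (P h).

Definition adversary_strategy (delta : R)
    (A : history -> 'rV[R]_N -> 'rV[R]_N) : Prop :=
  forall h p, prob_vector p -> admissible delta p (A h p).

Section Play.
Variables (P : history -> 'rV[R]_N) (A : history -> 'rV[R]_N -> 'rV[R]_N).

Fixpoint play (k : nat) : history :=
  if k is k'.+1 then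
    let h := play k' in rcons h (P h, A h (P h))
  else [::].

Definition pos_at (k : nat) : 'rV[R]_N := position (play k).

Definition move_at (k : nat) : 'rV[R]_N := A (play k) (P (play k)).
End Play.

Definition loss (delta : R) (T : nat) (x : R) : R :=
  if x <= - (delta * T%:R) then 1 else 0.

Definition final_loss (delta : R) (T : nat) P A : R :=
  N%:R^-1 * \sum_(i < N) loss delta T (pos_at P A T 0 i).

(* A is associated with the potential Lam, with total error at most err: its  *)
(* move depends only on the time, the positions and the announced p, and,     *)
(* whoever the opponent is, Lam decreases by at most eps k in round k.        *)
Definition associated_with (T : nat) (Lam : 'rV[R]_N -> R -> R) (err : R)
    (A : history -> 'rV[R]_N -> 'rV[R]_N) : Prop :=
  (exists rule : nat -> 'rV[R]_N -> 'rV[R]_N -> 'rV[R]_N,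
     forall h p, A h p = rule (size h) (position h) p) /\
  (exists2 eps : nat -> R,
     (forall k, 0 <= eps k) /\ \sum_(k < T) eps k <= err &
     forall P, player_strategy P -> forall k, (k < T)%N ->
       - eps k <= Lam (pos_at P A k + move_at P A k) (k%:R - T%:R + 1)
                  - Lam (pos_at P A k) (k%:R - T%:R)).

End Game.

Section Potential.
Context {R : realType}.

Definition gauss_tail (a : R) : R :=
  2 / Num.sqrt pi * \int[lebesgue_measure]_(x in `[a, +oo[) gauss_fun x.

Definition gtilde (s t : R) : R :=
  if 0 < s then gauss_tail (s / Num.sqrt (- 2 * t)) else 1.

Definition fpot (delta : R) (T : nat) (s t : R) : R :=
  gtilde (s + delta * T%:R) t.

(* The adversary freezes the chips at positions <= - barrier. *)
Definition barrier (delta theta : R) (T : nat) : R :=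
  (Num.ceil ((delta * T%:R + T%:R `^ (theta / 2)) / (1 - delta)))%:~R
    * (1 - delta).

(* The common value of beta and tau. *)
Definition shift (delta theta : R) (T : nat) : R :=
  barrier delta theta T - delta * T%:R.

Definition LambdaL (delta theta : R) (T N : nat) (s : 'rV[R]_N) (t : R) : R :=
  let beta := shift delta theta T in
  let tau := shift delta theta T in
  N%:R^-1 * (\sum_(i < N) fpot delta T (s 0 i + beta) (t - tau))
  - fpot delta T (- (delta * T%:R) + beta) (- tau).

End Potential.

(* Main.v *)
Require Import Defs.
From mathcomp Require Import all_boot all_order all_algebra.
From mathcomp Require Import all_classical all_reals all_analysis.
From mathcomp Require Import measurable_realfun zify ring lra.
Set Implicit Arguments.
Unset Strict Implicit.
Unset Printing Implicit Defensive.
Import Order.TTheory GRing.Theory Num.Theory.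
Import numFieldNormedType.Exports.
Local Open Scope classical_set_scope.
Local Open Scope ring_scope.

(** The heat kernel potential [G u b = gauss_tail (u / sqrt (2 b))] solves
    [d_b G = d_uu G / 2], so if an active chip at height [u] above the barrier
    moves by [+h] or [-h] with [h = 1 - delta], the average of the two new
    values of [G] falls below the old one by at most [O(delta / b + 1 / b^2)].
    It remains to choose the signs. A greedy choice keeps the signed sum of the
    half-differences [(G (u - h) - G (u + h)) / 2] below the largest of them,
    which is [O(1 / sqrt b)]; this bound is invariant under flipping all signs
    simultaneously, and one of the two sign patterns satisfies the player's
    constraint. Summed over the rounds these errors are [O(T^(-theta/4))].
    All positions lie on a lattice of mesh [h] containing the barrier, so a chip
    never jumps over it and is frozen exactly where [G = 1]. *)

(** * Calculus of the Gaussian tail and the discrete heat inequality *)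

Section GaussTail.
Context {R : realType}.
Implicit Types x y w : R.
Let mu := @lebesgue_measure R.

Lemma is_derive1_ge0_le (f df : R -> R) (a b : R) :
  a <= b -> (forall x, is_derive x 1 f (df x)) ->
  (forall x, a <= x <= b -> 0 <= df x) -> f a <= f b.
Proof.
move=> ab fdf df_ge0; rewrite -subr_ge0.
have [|c] := @MVT_segment R f df a b ab.
- by apply: derivable_within_continuous => x _; case: (fdf x).
- by rewrite in_itv /= => cab ->; rewrite mulr_ge0 ?subr_ge0// df_ge0.
Qed.

Lemma integrable_gauss (A : set R) :
  measurable A -> mu.-integrable A (EFin \o gauss_fun).
Proof. by move=> mA; apply: integrableS (integrableT_gauss). Qed.

(** Moves the variable from the lower to the upper limit of integration, the form to which the
    fundamental theorem of calculus applies. *)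
Lemma gauss_tailE x :
  gauss_tail x = 2 / Num.sqrt pi *
    (Num.sqrt pi - \int[mu]_(t in `]-oo, x]) gauss_fun t).
Proof.
rewrite /gauss_tail; congr (_ * _).
have <- : \int[mu]_(t in [set: R]) gauss_fun t = Num.sqrt pi.
  by rewrite /Rintegral integralT_gauss.
rewrite -(setUv `]-oo, x]%classic) Rintegral_setU//=; last 3 first.
- exact: measurableC.
- by apply: integrable_gauss; rewrite setUv.
- by rewrite disj_set2E setICr.
by rewrite addrAC subrr add0r setCitvl Rintegral_itv_obnd_cbnd// integrable_gauss.
Qed.

Lemma is_derive_gauss_tail x :
  is_derive x 1 (@gauss_tail R) (- (2 / Num.sqrt pi * gauss_fun x)).
Proof.
have [||||d1 d2] := @continuous_FTC1 R gauss_fun -oo%O x (x + 1) _ _ _ _.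
- by rewrite ltrDl.
- by apply: integrable_gauss.
- by rewrite ltNyr.
- exact: continuous_gauss_fun.
rewrite derive1E in d2.
have dF := derivableP d1; rewrite d2 in dF.
have -> : @gauss_tail R = (2 / Num.sqrt pi) \*: (cst (Num.sqrt pi) -
    (fun y => \int[mu]_(t in `]-oo, y]) gauss_fun t)).
  by apply/funext => y; rewrite gauss_tailE.
by apply: is_derive_eq; rewrite sub0r scalerN.
Qed.

Lemma gauss_tail0 : gauss_tail 0 = 1 :> R.
Proof.
rewrite /gauss_tail /Rintegral integral0y_gauss /=.
by rewrite mulrA divfK ?divff// sqrtr_eq0 -ltNge pi_gt0.
Qed.

Lemma two_div_sqrtpi_ge0 : 0 <= 2 / Num.sqrt pi :> R.
Proof. by rewrite divr_ge0// sqrtr_ge0. Qed.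

Lemma two_div_sqrtpi_le2 : 2 / Num.sqrt pi <= 2 :> R.
Proof.
rewrite ler_piMr// invf_le1 ?sqrtr_gt0 ?pi_gt0//.
by rewrite -[leLHS]sqrtr1 ler_sqrt ?pi_ge0// (le_trans _ (pi_ge2 R))// ler1n.
Qed.

Lemma gauss_tail_diff_ge0 x y : x <= y -> 0 <= gauss_tail x - gauss_tail y.
Proof.
move=> xy; have [|c _ E] := MVT_segment xy (fun z _ => is_derive_gauss_tail z).
  by apply: derivable_within_continuous => z _; case: (is_derive_gauss_tail z).
by rewrite -opprB E mulNr opprK !mulr_ge0 ?subr_ge0 ?expR_ge0.
Qed.

Lemma gauss_tail_diff_le x y :
  x <= y -> gauss_tail x - gauss_tail y <= 2 * (y - x).
Proof.
move=> xy; have [|c _ E] := MVT_segment xy (fun z _ => is_derive_gauss_tail z).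
  by apply: derivable_within_continuous => z _; case: (is_derive_gauss_tail z).
rewrite -opprB E mulNr opprK ler_wpM2r ?subr_ge0//.
rewrite -[leRHS]mulr1 ler_pM ?expR_ge0 ?two_div_sqrtpi_ge0//.
- exact: two_div_sqrtpi_le2.
- exact: gauss_fun_le1.
Qed.

Lemma gauss_fun_decr x y : 0 <= x -> x <= y -> gauss_fun y <= gauss_fun x.
Proof. by move=> x0 xy; rewrite ler_expR lerN2 ler_pXn2r// nnegrE (le_trans x0). Qed.

Lemma gauss_tail_diff_le_gauss x y : 0 <= x -> x <= y ->
  gauss_tail x - gauss_tail y <= 2 / Num.sqrt pi * gauss_fun x * (y - x).
Proof.
move=> x0 xy; have [|c] := MVT_segment xy (fun z _ => is_derive_gauss_tail z).
  by apply: derivable_within_continuous => z _; case: (is_derive_gauss_tail z).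
rewrite in_itv/= => /andP[xc cy] E.
rewrite -opprB E mulNr opprK ler_wpM2r ?subr_ge0//.
by rewrite ler_wpM2l ?two_div_sqrtpi_ge0// gauss_fun_decr.
Qed.

Lemma is_derive_gauss_fun x :
  is_derive x 1 (@gauss_fun R) (- (2 * x * gauss_fun x)).
Proof.
have dsq : is_derive x 1 (fun z : R => - z ^+ 2) (- (2 * x)).
  by apply: is_derive_eq; rewrite /GRing.scale/=; ring.
rewrite (_ : - _ = expR (- x ^+ 2) * - (2 * x)); last by rewrite /gauss_fun; ring.
exact: is_derive1_comp.
Qed.

(** On [[y, +oo[] the function [2 * y * gauss_fun t] is at most [2 * t * gauss_fun t], whose
    integral is [gauss_fun y <= 1]; the normalizing factor is at most 2. *)
Lemma gauss_tail_le_inv y : 0 < y -> gauss_tail y <= y^-1.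
Proof.
move=> y0.
have I : (\int[mu]_(t in `[y, +oo[) (2 * t * gauss_fun t)%:E = (gauss_fun y)%:E)%E.
  rewrite (@ge0_continuous_FTC2y R _ (fun t => - gauss_fun t) y 0).
  - by rewrite -EFinN -EFinD add0r opprK.
  - move=> t yt; rewrite !mulr_ge0 ?expR_ge0//; lra.
  - apply: continuous_subspaceT => t; apply: cvgM; last exact: continuous_gauss_fun.
    by apply: cvgM; [exact: cvg_cst|exact: cvg_id].
  - by rewrite -oppr0; apply: cvgN; exact: cvg_gauss_fun.
  - move=> t _; apply: derivableN; by case: (is_derive_gauss_fun t).
  - by apply: cvgN; apply: cvg_at_right_filter; exact: continuous_gauss_fun.
  - move=> t _; rewrite derive1E.
    have d := is_derive_gauss_fun t.
    by rewrite deriveN // derive_val opprK.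
have intq := integrable_gauss (measurable_itv `[y, +oo[).
have : (\int[mu]_(t in `[y, +oo[) ((2 * y)%:E * (gauss_fun t)%:E) <= 1)%E.
  apply: (@le_trans _ _ (gauss_fun y)%:E); last by rewrite lee_fin gauss_fun_le1.
  rewrite -I; apply: ge0_le_integral => //=.
  - by move=> t _; rewrite -EFinM lee_fin mulr_ge0 ?expR_ge0//; lra.
  - apply: measurable_funeM; apply/measurable_EFinP.
    by apply: measurable_funTS; exact: measurable_gauss_fun.
  - apply/measurable_EFinP; apply: measurable_funTS; apply: measurable_funM.
      by apply: measurable_funM.
    exact: measurable_gauss_fun.
  - move=> t; rewrite in_itv/= andbT => yt.
    by rewrite -EFinM lee_fin ler_wpM2r ?expR_ge0// ler_wpM2l.
rewrite integralZl//= => H.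
have {H} : 2 * y * \int[mu]_(t in `[y, +oo[) gauss_fun t <= 1.
  rewrite -lee_fin EFinM /Rintegral fineK//; exact: integrable_fin_num.
move=> H; rewrite /gauss_tail -[leRHS]mul1r ler_pdivlMr//.
set I' := \int[_]_(_ in _) _ in H *.
have I'0 : 0 <= I' by apply: Rintegral_ge0 => t _; exact: expR_ge0.
have := two_div_sqrtpi_le2; have := two_div_sqrtpi_ge0.
set c := _ / _ => c0 c2.
have : c * (I' * y) <= 2 * (I' * y) by rewrite ler_wpM2r// mulr_ge0// ltW.
lra.
Qed.

Lemma expR_subN_ge x : 0 <= x -> 2 * x <= expR x - expR (- x).
Proof.
move=> x0; rewrite -subr_ge0.
have := @is_derive1_ge0_le (fun z => expR z - expR (- z) - 2 * z)
  (fun z => expR z + expR (- z) - 2) 0 x x0.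
rewrite mulr0 oppr0 subrr addr0; apply.
- move=> z.
  have dN : is_derive z 1 (fun z : R => expR (- z)) (- expR (- z)).
    have dN : is_derive z 1 (-%R : R -> R) (- 1) := is_deriveNid _ _.
    by rewrite -mulrN1; exact: is_derive1_comp.
  have -> : (fun z => expR z - expR (- z) - 2 * z) =
    expR - (fun z => expR (- z)) - 2 \*: id by [].
  by apply: is_derive_eq; rewrite opprK scaler1.
(* The derivative is [a + b - 2] with [a * b = 1], hence nonnegative by the arithmetic-geometric
   mean inequality. *)
- move=> z _; have := expR_gt0 z; have : expR z * expR (- z) = 1.
    by rewrite -expRD subrr expR0.
  set a := expR z; set b := expR (- z) => ab a0.
  have : 0 <= (a - b) ^+ 2 by exact: sqr_ge0.
  have b0 : 0 < b by exact: expR_gt0.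
  nra.
Qed.

(** Factoring out the exponentials of [- y ^+ 2] and [- z ^+ 2] leaves [2 sinh (2 y z)], which is at
    least [4 y z]; the second factor is at least [1 - z ^+ 2]. *)
Lemma gauss_fun_diff_ge y z : 0 <= y -> 0 <= z ->
  4 * y * z * gauss_fun y * (1 - z ^+ 2) <= gauss_fun (y - z) - gauss_fun (y + z).
Proof.
move=> y0 z0; rewrite /gauss_fun.
have -> : - (y - z) ^+ 2 = - y ^+ 2 + - z ^+ 2 + 2 * y * z by ring.
have -> : - (y + z) ^+ 2 = - y ^+ 2 + - z ^+ 2 + - (2 * y * z) by ring.
rewrite !expRD -mulrBr.
have yz0 : 0 <= 2 * y * z by rewrite !mulr_ge0.
have := expR_subN_ge yz0; set S := _ - _ => hS.
have := expR_ge1Dx (- z ^+ 2); set Z := expR (- z ^+ 2) => hZ.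
have Y0 := expR_gt0 (- y ^+ 2); set Y := expR (- y ^+ 2) in Y0 *.
have Z0 : 0 < Z by exact: expR_gt0.
have -> : 4 * y * z * Y * (1 - z ^+ 2) = Y * (1 - z ^+ 2) * (2 * (2 * y * z)) by ring.
apply: (@le_trans _ _ (Y * Z * (2 * (2 * y * z)))).
  by rewrite ler_wpM2r ?ler_wpM2l ?(ltW Y0)// mulr_ge0.
by rewrite ler_wpM2l// mulr_ge0// ltW.
Qed.

(* A lower bound on the discrete second difference with an [O(w^4)] error: its
   [w]-derivative involves [gauss_fun (y - z) - gauss_fun (y + z)], a hyperbolic
   sine bounded below by its argument. *)
Lemma gauss_tail_midpoint y w : 0 <= y -> 0 <= w ->
  2 / Num.sqrt pi * (y * gauss_fun y) * (w ^+ 2 - w ^+ 4 / 2) <=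
  (gauss_tail (y + w) + gauss_tail (y - w)) / 2 - gauss_tail y.
Proof.
move=> y0 w0; rewrite -subr_ge0; set c := 2 / _.
pose F z := (gauss_tail (y + z) + gauss_tail (y - z)) / 2
   - gauss_tail y - c * (y * gauss_fun y) * (z ^+ 2 - z ^+ 4 / 2).
have F0 : F 0 = 0 by rewrite /F !(addr0, subr0, expr0n)/=; field.
rewrite -F0 -/(F w).
apply: (is_derive1_ge0_le (df := fun z => c * ((gauss_fun (y - z) - gauss_fun (y + z)) / 2
         - (y * gauss_fun y) * (2 * z - 2 * z ^+ 3)))) => //.
  move=> z.
  have dyp : is_derive z 1 (fun z => y + z) 1.
    by rewrite -[X in is_derive _ _ _ X]add0r; apply: (is_deriveD (f := cst y)).
  have dym : is_derive z 1 (fun z => y - z) (- 1).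
    by rewrite -[X in is_derive _ _ _ X]add0r; apply: (is_deriveD (f := cst y)).
  have dp : is_derive z 1 (fun z => gauss_tail (y + z)) (- (c * gauss_fun (y + z))).
    rewrite -[- _]mulr1; apply: is_derive1_comp; exact: is_derive_gauss_tail.
  have dm : is_derive z 1 (fun z => gauss_tail (y - z)) (c * gauss_fun (y - z)).
    rewrite -[c * _]opprK -mulrN1; apply: is_derive1_comp; exact: is_derive_gauss_tail.
  rewrite (_ : F = 2^-1 \*: ((fun z => gauss_tail (y + z)) + (fun z => gauss_tail (y - z)))
     - cst (gauss_tail y)
     - (c * (y * gauss_fun y)) \*: (id ^+ 2 - 2^-1 \*: (id ^+ 4))); last first.
    apply/funext => t; rewrite /F !fctE /= /GRing.scale /=; ring.
  by apply: is_derive_eq; rewrite /GRing.scale /=; field.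
move=> z /andP[z0 _].
rewrite mulr_ge0 ?two_div_sqrtpi_ge0//.
have := gauss_fun_diff_ge y0 z0.
lra.
Qed.

Lemma mul_gauss_le1 y : y * gauss_fun y <= 1.
Proof.
rewrite /gauss_fun expRN ler_pdivrMr ?expR_gt0// mul1r.
by apply: le_trans (expR_ge1Dx _); have := sqr_ge0 (y - 1); rewrite expr2; nra.
Qed.

Lemma cube_gauss_le1 y : y ^+ 3 * gauss_fun y <= 1.
Proof.
rewrite /gauss_fun expRN ler_pdivrMr ?expR_gt0// mul1r.
(* Halving the exponent bounds the exponential below by [(1 + y ^+ 2 / 2) ^+ 2], which equals
   [1 + y ^+ 3 + (y ^+ 2 / 2 - y) ^+ 2]. *)
have -> : y ^+ 2 = y ^+ 2 / 2 + y ^+ 2 / 2 by field.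
have := expR_ge1Dx (y ^+ 2 / 2); rewrite expRD; set E := expR _ => hE.
have y2 := sqr_ge0 y; have h2 := sqr_ge0 (y ^+ 2 / 2 - y).
apply: (@le_trans _ _ ((1 + y ^+ 2 / 2) * (1 + y ^+ 2 / 2))).
  nra.
by rewrite ler_pM//; lra.
Qed.

(** With [y = u / sqrt (2 b)], the spatial average gains about
    [c * y * gauss_fun y * h ^+ 2 / (2 * b)], while the elapsed unit of time costs about the same
    without [h ^+ 2]. What is left is [1 - h ^+ 2 <= 2 * (1 - h)] over [b], plus second-order
    terms. *)
Lemma gauss_tail_heat_step (b h u : R) : 1 <= b -> 0 <= h -> h <= 1 -> 0 <= u ->
  gauss_tail (u / Num.sqrt (2 * (b + 1))) - (2 * (1 - h) / b + 2 / b ^+ 2) <=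
  (gauss_tail ((u + h) / Num.sqrt (2 * b)) +
   gauss_tail ((u - h) / Num.sqrt (2 * b))) / 2.
Proof.
move=> b1 h0 h1 u0.
have b0 : 0 < b by lra.
set r := Num.sqrt (2 * b); set r' := Num.sqrt (2 * (b + 1)).
have r0 : 0 < r by rewrite sqrtr_gt0; lra.
have r'0 : 0 < r' by rewrite sqrtr_gt0; lra.
have rr : r ^+ 2 = 2 * b by rewrite sqr_sqrtr//; lra.
have rr' : r' ^+ 2 = 2 * (b + 1) by rewrite sqr_sqrtr//; lra.
set y := u / r; set w := h / r; set y' := u / r'.
have -> : (u + h) / r = y + w by rewrite mulrDl.
have -> : (u - h) / r = y - w by rewrite mulrBl.
have y0 : 0 <= y by rewrite divr_ge0// ltW.
have y'0 : 0 <= y' by rewrite divr_ge0// ltW.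
have w0 : 0 <= w by rewrite divr_ge0// ltW.
have w2 : w ^+ 2 = h ^+ 2 / (2 * b) by rewrite expr_div_n rr.
have yy' : y ^+ 2 = y' ^+ 2 + y' ^+ 2 / b.
  rewrite !expr_div_n rr rr'; field; lra.
have le1 : y' <= y.
  rewrite -(@ler_pXn2r _ 2)// ?nnegrE// yy' lerDl divr_ge0// ?sqr_ge0//; lra.
have le2 : y - y' <= y' / (2 * b).
  rewrite lerBlDl -(@ler_pXn2r _ 2)// ?nnegrE ?addr_ge0// ?divr_ge0//; try lra.
  rewrite yy' sqrrD -addrA lerD2l.
  have -> : y' * (y' / (2 * b)) *+ 2 = y' ^+ 2 / b by field; lra.
  by rewrite lerDl sqr_ge0.
set c : R := 2 / Num.sqrt pi.
have c0 : 0 <= c := two_div_sqrtpi_ge0.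
have c2 : c <= 2 := two_div_sqrtpi_le2.
set g := gauss_fun y; set g' := gauss_fun y'.
have g0 : 0 <= g by exact: expR_ge0.
have g'0 : 0 <= g' by exact: expR_ge0.
have gg' : g' * (1 - y' ^+ 2 / b) <= g.
  rewrite /g /gauss_fun yy' opprD expRD ler_wpM2l//.
  exact: expR_ge1Dx.
have H1 : gauss_tail y' - gauss_tail y <= c * g' * (y' / (2 * b)).
  apply: le_trans (gauss_tail_diff_le_gauss y'0 le1) _.
  by rewrite ler_wpM2l// mulr_ge0.
have := mul_gauss_le1 y; rewrite -/g => yg1.
have := cube_gauss_le1 y'; rewrite -/g' => yg3.
have yg0 : 0 <= y * g by rewrite mulr_ge0.
(* The time cost is expressed at [y'] but the gain at [y]; passing from one to the other costs
   [y' ^+ 3 * g' / b], at most [1 / b] by the cubic bound. *)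
have H2 : y' * g' <= y * g + b^-1.
  have A1 : y' * (g' * (1 - y' ^+ 2 / b)) <= y * g.
    by apply: (@le_trans _ _ (y' * g)); [exact: ler_wpM2l|exact: ler_wpM2r].
  have A2 : y' ^+ 3 * g' / b <= 1 / b by rewrite ler_pM2r// invr_gt0.
  lra.
have := gauss_tail_midpoint y0 w0; rewrite -/c -/g.
rewrite (_ : w ^+ 4 = (w ^+ 2) ^+ 2); last by rewrite -exprM.
rewrite w2 invfM -exprVn => H3.
have bV0 : 0 < b^-1 by rewrite invr_gt0.
have H1' : c * g' * (y' / (2 * b)) <= c * (b^-1 / 2) * (y * g + b^-1).
  rewrite (_ : c * g' * (y' / (2 * b)) = c * (b^-1 / 2) * (y' * g')).
    by rewrite ler_wpM2l// mulr_ge0// divr_ge0// ltW.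
  by field; lra.
move: H1' H1 H3; move: (b^-1) bV0 (y * g) yg0 yg1 => v v0 k k0 k1 H1' H1 H3.
have h2 : 0 <= 1 - h ^+ 2 by rewrite subr_ge0 expr_le1.
have h4 : h ^+ 4 <= 1 by rewrite expr_le1.
have H5 : k * (1 - h ^+ 2) <= 2 * (1 - h).
  apply: (@le_trans _ _ (1 * (1 - h ^+ 2))); first by rewrite ler_wpM2r.
  by rewrite mul1r (_ : 1 - h ^+ 2 = (1 + h) * (1 - h)) ?ler_wpM2r//; [lra|lra|ring].
have H6 : k * h ^+ 4 <= 1 by rewrite mulr_ile1// exprn_ge0.
(* The left side is the bound on the time cost minus the spatial gain, with [v] for [1 / b] and [k]
   for [y * g]. *)
have H7 : c * (v / 2) * (k * (1 - h ^+ 2) + v + k * h ^+ 4 * v / 4) <=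
   2 * (v / 2) * (2 * (1 - h) + v + 1 * v / 4).
  apply: ler_pM.
  - by rewrite mulr_ge0// divr_ge0// ltW.
  - by rewrite !addr_ge0// ?mulr_ge0 ?exprn_ge0// ltW.
  - by rewrite ler_wpM2r// divr_ge0// ltW.
  - by rewrite !lerD// !ler_wpM2r// ltW.
have := sqr_ge0 v.
lra.
Qed.
End GaussTail.

(** * Choosing signs that balance a sum *)

Section Signs.
Context {R : realDomainType}.

Definition signing (I : Type) (sg : I -> R) := forall i, sg i = 1 \/ sg i = -1.

(** Each new term is given the sign opposite to the running sum [S], so the new sum is at most the
    larger of [S] and the term in absolute value. The signs do not depend on [M]. *)
Lemma greedy_signing (I : eqType) (s : seq I) (d : I -> R) : uniq s ->
  exists2 sg : I -> R, signing sg &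
    forall M, 0 <= M -> (forall i, `|d i| <= M) ->
      `|\sum_(i <- s) d i * sg i| <= M.
Proof.
elim: s => [_|a s IHs /= /andP[as_ us]].
  exists (fun=> 1); first by left.
  by move=> M M0 _; rewrite big_nil normr0.
have [sg sgP sgM] := IHs us.
pose S := \sum_(i <- s) d i * sg i.
exists (fun i => if i == a then if 0 <= S * d a then -1 else 1 else sg i).
  by move=> i; case: ifP => // _; case: ifP; [right|left].
move=> M M0 dM; rewrite big_cons eqxx.
rewrite (_ : \sum_(_ <- _) _ = S); last first.
  rewrite /S !big_seq; apply: eq_bigr => i i_s.
  by case: eqVneq i_s as_ => // -> ->.
have := dM a; have := sgM M M0 dM; rewrite -/S !ler_norml.
move=> /andP[S1 S2] /andP[d1 d2].
case: ifP => [Sd|/negbT]; [|rewrite -ltNge => Sd].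
  case: (ltrgt0P (d a)) => da; [|have : S <= 0|]; nra.
case: (ltrgt0P (d a)) => da; nra.
Qed.

(* Among [sg] and [-sg], one pairs nonnegatively with [p]; both satisfy the bound. *)
Lemma balanced_signing (I : finType) (d p : I -> R) :
  exists sg : I -> R, [/\ signing sg, 0 <= \sum_i p i * sg i &
    forall M, 0 <= M -> (forall i, `|d i| <= M) -> `|\sum_i d i * sg i| <= M].
Proof.
have [sg sgP sgM] := greedy_signing d (index_enum_uniq I).
have [p0|p0] := leP 0 (\sum_i p i * sg i); first by exists sg.
exists (fun i => - sg i); split.
- by move=> i; case: (sgP i) => ->; [right|left; rewrite opprK].
- under eq_bigr do rewrite mulrN.
  by rewrite sumrN oppr_ge0 ltW.
- move=> M M0 dM; under eq_bigr do rewrite mulrN.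
  by rewrite sumrN normrN; exact: sgM.
Qed.
End Signs.

(** * Telescoping bounds for the error series *)

Section Sums.
Context {R : rcfType}.

(** Each term is at most [1 / sqrt (n + 1) <= 2 * (sqrt (n + 1) - sqrt n)], which telescopes. *)
Lemma sum_inv_sqrt_le (c : R) n : 1 <= c ->
  \sum_(j < n) (Num.sqrt (c + j%:R))^-1 <= 2 * Num.sqrt n%:R.
Proof.
move=> c1; elim: n => [|n IH]; first by rewrite big_ord0 sqrtr0 mulr0.
have n0 : 0 <= n%:R :> R by [].
have le1 : (Num.sqrt (c + n%:R))^-1 <= (Num.sqrt n.+1%:R)^-1.
  by rewrite lef_pV2 ?posrE ?sqrtr_gt0 ?ler_sqrt//; rewrite -?natr1 ; lra.
rewrite big_ord_recr /=; apply: le_trans (lerD IH le1) _.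
have a0 : 0 <= Num.sqrt n%:R :> R by exact: sqrtr_ge0.
have b0 : 0 < Num.sqrt n.+1%:R :> R by rewrite sqrtr_gt0.
have : Num.sqrt n%:R ^+ 2 = n%:R :> R by rewrite sqr_sqrtr.
have : Num.sqrt n.+1%:R ^+ 2 = n%:R + 1 :> R by rewrite sqr_sqrtr// natr1.
move: a0 b0; set a := Num.sqrt n%:R; set b := Num.sqrt _.
move=> a0 b0 hb ha.
suff : b^-1 <= 2 * (b - a) by lra.
rewrite -(ler_pM2r b0) mulVf ?gt_eqF//.
have := sqr_ge0 (a - b); nra.
Qed.

(** For [x >= 1], [1 / x ^+ 2 <= 2 / (x * (x + 1)) = 2 / x - 2 / (x + 1)], which telescopes. *)
Lemma sum_inv_sqr_le (c : R) n : 1 <= c ->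
  \sum_(j < n) ((c + j%:R) ^+ 2)^-1 <= 2 / c - 2 / (c + n%:R).
Proof.
move=> c1; elim: n => [|n IH]; first by rewrite big_ord0 addr0 subrr.
rewrite big_ord_recr /=; apply: le_trans (lerD IH (lexx _)) _.
rewrite -(natr1 n) -addrA lerD2l addrA.
have n0 : 0 <= n%:R :> R by [].
have : 1 <= c + n%:R by lra.
move: (c + _) => x x1.
rewrite -subr_ge0 (_ : _ - _ = (x - 1) / (x ^+ 2 * (x + 1))).
  by rewrite divr_ge0 ?mulr_ge0 ?exprn_ge0//; lra.
by field; apply/andP; split; lra.
Qed.
End Sums.

(** * The adversary's rule and its error per round *)

Section Adversary.
Context {R : realType} {N : nat}.
Implicit Types (p s : 'rV[R]_N) (P : @history R N -> 'rV[R]_N).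
Variables (h B tau : R) (T : nat).

(** The heat time [b] after round [k]; before the round it is larger by 1. *)
Definition time_left (k : nat) : R := tau + (T - k.+1)%:R.

(** Moving an active chip by [h * sg] makes its new potential the average of the two outcomes minus
    [slope * sg]. Frozen chips get 0 here and in [stake], so their signs are irrelevant. *)
Definition slope (k : nat) s (i : 'I_N) : R :=
  let r := Num.sqrt (2 * time_left k) in
  if s 0 i <= - B then 0 else
  (gauss_tail ((s 0 i + B - h) / r) - gauss_tail ((s 0 i + B + h) / r)) / 2.

Definition stake s p (i : 'I_N) : R := if s 0 i <= - B then 0 else p 0 i.

Definition signs k s p : 'I_N -> R :=
  projT1 (cid (balanced_signing (slope k s) (stake s p))).

Definition rule k s p : 'rV[R]_N :=
  \row_i (if s 0 i <= - B then 0 else h * signs k s p i).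

Definition adversary (H : @history R N) p := rule (size H) (position H) p.

Lemma signsP k s p : [/\ signing (signs k s p),
   0 <= \sum_i stake s p i * signs k s p i &
   forall M, 0 <= M -> (forall i, `|slope k s i| <= M) ->
     `|\sum_i slope k s i * signs k s p i| <= M].
Proof. exact: (projT2 (cid (balanced_signing (slope k s) (stake s p)))). Qed.

Lemma rule_admissible (delta : R) k s p : h = 1 - delta -> 0 <= delta < 1 ->
  admissible delta p (rule k s p).
Proof.
move=> hE /andP[d0 d1]; have [sg ss _] := signsP k s p; split.
  move=> i; rewrite mxE; case: ifP => _; first by apply/andP; split; lra.
  by case: (sg i) => ->; apply/andP; split; lra.
rewrite (_ : \sum_i _ = h * \sum_i stake s p i * signs k s p i).
  by rewrite mulr_ge0//; lra.
rewrite mulr_sumr; apply: eq_bigr => i _; rewrite mxE /stake.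
by case: ifP => _; [rewrite !(mul0r, mulr0)|ring].
Qed.

Lemma rule_entry k s p i :
  0 <= h -> (s 0 i <= - B -> rule k s p 0 i = 0) /\
            (- B < s 0 i -> `|rule k s p 0 i| = h).
Proof.
move=> h0; rewrite mxE; split=> [->//|]; rewrite ltNge => /negbTE ->.
have [sg _ _] := signsP k s p.
by case: (sg i) => ->; rewrite ?mulr1 ?mulrN1 ?normrN ger0_norm.
Qed.

Section PlayFacts.
Variable P : @history R N -> 'rV[R]_N.
Let A := adversary.

Lemma size_play (A' : @history R N -> 'rV[R]_N -> 'rV[R]_N) k :
  size (play P A' k) = k.
Proof. by elim: k => //= k IH; rewrite size_rcons IH. Qed.

Lemma pos_atS (A' : @history R N -> 'rV[R]_N -> 'rV[R]_N) k :
  pos_at P A' k.+1 = pos_at P A' k + move_at P A' k.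
Proof. by rewrite /pos_at /position /= big_rcons/= addrC. Qed.

Lemma pos_at0 (A' : @history R N -> 'rV[R]_N -> 'rV[R]_N) : pos_at P A' 0 = 0.
Proof. by rewrite /pos_at /position big_nil. Qed.

Lemma move_atE k :
  move_at P A k = rule k (pos_at P A k) (P (play P A k)).
Proof. by rewrite /move_at {1}/A /adversary size_play. Qed.

(** Ensures that a chip strictly above the barrier is at least [h] above it, since the barrier is on
    the lattice too. *)
Lemma pos_at_lattice k i : exists m : int, pos_at P A k 0 i = m%:~R * h.
Proof.
elim: k => [|k [m IH]]; first by exists 0; rewrite pos_at0 mxE mul0r.
rewrite pos_atS mxE IH move_atE mxE; case: ifP => _.
  by exists m; rewrite addr0.
have [sg _ _] := signsP k (pos_at P A k) (P (play P A k)).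
case: (sg i) => ->; [exists (m + 1)|exists (m - 1)]; rewrite ?rmorphB ?rmorphD/=; ring.
Qed.

(** The case [x = 0], where [gtilde] is 1 by definition, agrees with the formula because
    [gauss_tail 0 = 1]; a chip landing exactly on the barrier needs this. *)
Lemma gtildeE (x b : R) : 0 <= x ->
  gtilde x (- b) = gauss_tail (x / Num.sqrt (2 * b)).
Proof.
rewrite /gtilde mulrNN le_eqVlt => /predU1P[<-|->//].
by rewrite ltxx mul0r gauss_tail0.
Qed.

Hypotheses (h_ge0 : 0 < h) (h_le1 : h <= 1) (tau_ge1 : 1 <= tau).
Hypothesis B_lattice : exists m : int, B = m%:~R * h.

Lemma time_left_ge1 k : 1 <= time_left k.
Proof. by rewrite /time_left ler_wpDr. Qed.

Lemma time_left_gt0 k : 0 < time_left k.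
Proof. exact: lt_le_trans (time_left_ge1 k). Qed.

Lemma chip_error_ge0 k : 0 <= 2 * (1 - h) / time_left k + 2 / time_left k ^+ 2.
Proof.
have b0 := ltW (time_left_gt0 k).
by rewrite addr_ge0// divr_ge0 ?exprn_ge0// mulr_ge0// subr_ge0.
Qed.

Lemma chip_increment k i :
  - (2 * (1 - h) / time_left k + 2 / time_left k ^+ 2)
  - slope k (pos_at P A k) i * signs k (pos_at P A k) (P (play P A k)) i <=
  gtilde ((pos_at P A k + move_at P A k) 0 i + B) (- time_left k)
  - gtilde (pos_at P A k 0 i + B) (- (time_left k + 1)).
Proof.
have h0 := h_ge0; have b1 := time_left_ge1 k.
have [sg _ _] := signsP k (pos_at P A k) (P (play P A k)).
rewrite move_atE !mxE /slope.
(* A frozen chip has potential 1 before and after the round. *)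
case: ifP => [sB|/negbT]; last rewrite -ltNge => sB.
  rewrite addr0 mul0r subr0 /gtilde ifF; last by apply/negbTE; rewrite -leNgt; lra.
  rewrite ifF; last by apply/negbTE; rewrite -leNgt; lra.
  by rewrite subrr oppr_le0 chip_error_ge0.
have uh : h <= pos_at P A k 0 i + B.
  have [m mE] := pos_at_lattice k i; have [n nE] := B_lattice.
  move: sB; rewrite -subr_gt0 opprK mE nE -mulrDl -intrD pmulr_lgt0// ltr0z => mn.
  by rewrite -[leLHS]mul1r ler_wpM2r ?(ltW h_ge0)// ler1z.
have := gauss_tail_heat_step b1 (ltW h_ge0) h_le1 (le_trans (ltW h_ge0) uh).
rewrite (gtildeE (time_left k + 1)); last lra.
case: (sg i) => ->; rewrite ?mulr1 ?mulrN1 gtildeE; try lra.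
  rewrite [_ + h + B]addrAC; lra.
rewrite [_ - h + B]addrAC; lra.
Qed.

(** [gauss_tail] is 2-Lipschitz and the two arguments are [2 * h / r] apart. *)
Lemma slope_le k s i : `|slope k s i| <= 2 / Num.sqrt (time_left k).
Proof.
have h0 := h_ge0; have h1 := h_le1; have b1 := time_left_ge1 k; rewrite /slope.
have b0 : 0 < time_left k by lra.
case: ifP => _; first by rewrite normr0 divr_ge0 ?sqrtr_ge0.
set r := Num.sqrt (2 * _).
have r0 : 0 < r by rewrite sqrtr_gt0 mulr_gt0.
set x := (_ - h) / r; set y := (_ + h) / r.
have yx : y - x = 2 * h / r by rewrite /x /y; field; lra.
have xy : x <= y by rewrite -subr_ge0 yx divr_ge0 ?mulr_ge0// ltW.
have D0 := gauss_tail_diff_ge0 xy.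
rewrite ger0_norm ?divr_ge0//.
apply: (@le_trans _ _ (2 * h / r)).
  by have := gauss_tail_diff_le xy; rewrite yx; lra.
rewrite ler_pM ?mulr_ge0 ?invr_ge0 ?sqrtr_ge0//; try lra.
have st0 : 0 < Num.sqrt (time_left k) by rewrite sqrtr_gt0.
have tr : Num.sqrt (time_left k) <= r by rewrite ler_sqrt; lra.
by rewrite lef_pV2 ?posrE.
Qed.

(** The first two terms are the heat-step defect of one chip; the last is the residue of the signed
    sum of slopes, no larger than the bound on a single slope, divided among [N] chips. *)
Definition round_error k : R :=
  2 * (1 - h) / time_left k + 2 / time_left k ^+ 2 +
  2 / Num.sqrt (time_left k) / N%:R.

Lemma round_error_ge0 k : 0 <= round_error k.
Proof.
by rewrite addr_ge0 ?chip_error_ge0// !divr_ge0 ?sqrtr_ge0.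
Qed.

Lemma mean_increment k : (0 < N)%N ->
  - round_error k <=
  N%:R^-1 * (\sum_(i < N)
     gtilde ((pos_at P A k + move_at P A k) 0 i + B) (- time_left k)) -
  N%:R^-1 * (\sum_(i < N) gtilde (pos_at P A k 0 i + B) (- (time_left k + 1))).
Proof.
move=> N0; have N0' : 0 < N%:R :> R by rewrite ltr0n.
rewrite -mulrBr -sumrB.
have [_ _ sM] := signsP k (pos_at P A k) (P (play P A k)).
have M0 : 0 <= 2 / Num.sqrt (time_left k) by rewrite divr_ge0 ?sqrtr_ge0.
have sle := le_trans (ler_norm _) (sM _ M0 (slope_le k (pos_at P A k))).
rewrite mulrC ler_pdivlMr//.
apply: (le_trans _ (ler_sum _ (fun i _ => chip_increment k i))).
rewrite sumrB sumr_const card_ord -[X in _ <= X - _]mulr_natr /round_error.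
rewrite opprD mulrDl. rewrite lerD2l mulNr divfK ?gt_eqF// lerN2.
exact: sle.
Qed.

Lemma sum_round_error : (0 < N)%N ->
  \sum_(k < T) round_error k <=
  4 * (1 - h) * Num.sqrt T%:R / Num.sqrt tau + 4 / tau + 4 * Num.sqrt T%:R / N%:R.
Proof.
(* Counting rounds from the end turns [time_left] into [tau + j]. *)
move=> N0; rewrite (reindex_inj rev_ord_inj)/=.
have tE (j : 'I_T) : time_left (T - j.+1) = tau + j%:R.
  by rewrite /time_left subnSK// subKn// ltnW.
have sb0 := sum_inv_sqrt_le T tau_ge1.
have sb1 := sum_inv_sqr_le T tau_ge1.
set S1 := \sum_(_ < _) _ in sb0; set S2 := \sum_(_ < _) _ in sb1.
have tau0 : 0 < tau := lt_le_trans ltr01 tau_ge1.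
have T0 : 0 <= T%:R :> R by [].
have st0 : 0 < Num.sqrt tau by rewrite sqrtr_gt0.
(* For [x >= tau], [1 / x] is at most [1 / (sqrt tau * sqrt x)], so [S1] also controls the harmonic
   sum. The resulting [sqrt T] is harmless, as [delta * sqrt T] is constant. *)
apply: (@le_trans _ _ (2 * (1 - h) / Num.sqrt tau * S1 + 2 * S2 + 2 / N%:R * S1)).
  rewrite !mulr_sumr -!big_split/=; apply: ler_sum => j _.
  rewrite /round_error tE.
  set x := tau + j%:R.
  have xt : tau <= x by rewrite /x ler_wpDr.
  have x0 : 0 < x by lra.
  have sx0 : 0 < Num.sqrt x by rewrite sqrtr_gt0.
  rewrite !lerD//; last by rewrite mulrAC.
  rewrite -!mulrA ler_wpM2l// ler_wpM2l ?subr_ge0//.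
  rewrite -{1}[x]sqr_sqrtr ?(ltW x0)// expr2 invfM ler_wpM2r ?invr_ge0 ?sqrtr_ge0//.
  by rewrite lef_pV2 ?posrE// ler_sqrt// ltW.
have -> : 4 * (1 - h) * Num.sqrt T%:R / Num.sqrt tau =
  2 * (1 - h) / Num.sqrt tau * (2 * Num.sqrt T%:R) by field; lra.
have -> : 4 * Num.sqrt T%:R / N%:R = 2 / N%:R * (2 * Num.sqrt T%:R) :> R.
  by field; rewrite pnatr_eq0; lia.
rewrite !lerD//.
- by rewrite ler_wpM2l// divr_ge0 ?mulr_ge0 ?subr_ge0 ?sqrtr_ge0.
- have : 0 <= 2 / (tau + T%:R) by rewrite divr_ge0//; lra.
  lra.
- by rewrite ler_wpM2l// divr_ge0.
Qed.
End PlayFacts.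
End Adversary.

(** * From the potential to the final loss *)

Section Endgame.
Context {R : realType}.

(** A chip without loss ends more than [tau] above the barrier, so the tail is taken beyond
    [sqrt (tau / 2)] and is at most [2 / sqrt tau]. A chip with loss counts 1, which bounds the
    potential. *)
Lemma gtilde_le_loss (delta B tau : R) (T : nat) (x : R) : 0 < tau ->
  tau = B - delta * T%:R ->
  gtilde (x + B) (- tau) <= loss delta T x + 2 / Num.sqrt tau.
Proof.
move=> tau0 tauE; have e0 : 0 <= 2 / Num.sqrt tau by rewrite divr_ge0 ?sqrtr_ge0.
have st0 : 0 < Num.sqrt tau by rewrite sqrtr_gt0.
have r0 : 0 < Num.sqrt (2 * tau) by rewrite sqrtr_gt0 mulr_gt0.
rewrite /loss; case: ifP => [_|/negbT]; last rewrite -ltNge => xl.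
  have [u0|u0] := leP 0 (x + B); last by rewrite /gtilde ltNge (ltW u0)/=; lra.
  rewrite gtildeE//; have y0 : 0 <= (x + B) / Num.sqrt (2 * tau).
    by rewrite divr_ge0// ltW.
  by have := gauss_tail_diff_ge0 y0; rewrite gauss_tail0; lra.
have xB : tau < x + B by rewrite tauE; lra.
rewrite add0r gtildeE; last by rewrite ltW// (lt_trans tau0).
set r := Num.sqrt (2 * tau) in r0 *.
have y0 : 0 < (x + B) / r by rewrite divr_gt0// (lt_trans tau0).
apply: le_trans (gauss_tail_le_inv y0) _.
rewrite invf_div ler_pdivrMr; last by rewrite (lt_trans tau0).
have tt : Num.sqrt tau ^+ 2 = tau by rewrite sqr_sqrtr// ltW.
have rt : r <= 2 * Num.sqrt tau.
  rewrite -(@ler_pXn2r _ 2)// ?nnegrE ?mulr_ge0 ?(ltW r0) ?(ltW st0)//.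
  by rewrite exprMn tt sqr_sqrtr; lra.
apply: le_trans rt _.
rewrite (_ : 2 * Num.sqrt tau = 2 / Num.sqrt tau * tau).
  by rewrite ler_wpM2l// ltW.
by rewrite -{3}tt; field; lra.
Qed.

Lemma final_loss_ge (N T : nat) (delta B tau : R)
    (P : @history R N -> 'rV[R]_N) :
  (0 < N)%N -> 0 <= delta < 1 -> 1 <= tau -> tau = B - delta * T%:R ->
  (exists m : int, B = m%:~R * (1 - delta)) ->
  gauss_tail (B / Num.sqrt (2 * (tau + T%:R)))
  - \sum_(k < T) @round_error R N (1 - delta) tau T k - 2 / Num.sqrt tau <=
  final_loss delta T P (adversary (1 - delta) B tau T).
Proof.
move=> N0 /andP[d0 d1] tau1 tauE BL; set A := adversary _ _ _ _.
have tau0 : 0 < tau by lra.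
have N0' : N%:R != 0 :> R by rewrite pnatr_eq0 -lt0n.
have dT0 : 0 <= delta * T%:R by rewrite mulr_ge0.
have B0 : 0 <= B by lra.
(* The mean potential before round [k]: all chips start at 0, so [M 0] is a single tail value, and
   [M T] is compared with the loss. *)
pose M k := N%:R^-1 * \sum_(i < N) gtilde (pos_at P A k 0 i + B)
  (- (tau + (T - k)%:R)).
have step k : (k < T)%N -> M k - @round_error R N (1 - delta) tau T k <= M k.+1.
  move=> kT.
  have := @mean_increment R N (1 - delta) B tau T P _ _ tau1 BL k N0.
  rewrite -pos_atS /time_left -/A -/(M k.+1).
  rewrite (_ : tau + (T - k.+1)%:R + 1 = tau + (T - k)%:R).
    by rewrite -/(M k) => /(_ _ _); lra.
  by rewrite -addrA natr1 subnSK.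
have M0 : M 0%N = gauss_tail (B / Num.sqrt (2 * (tau + T%:R))).
  rewrite /M; under eq_bigr do rewrite pos_at0 mxE add0r gtildeE// subn0.
  by rewrite sumr_const card_ord -[X in _ * X]mulr_natr mulrCA mulVf ?mulr1.
have MT : M T <= final_loss delta T P A + 2 / Num.sqrt tau.
  rewrite /M subnn addr0 /final_loss.
  rewrite -[2 / _](mulKf N0') -mulrDr ler_wpM2l ?invr_ge0//.
  rewrite mulrC mulr_natr -[X in _ *+ X](card_ord N) -sumr_const -big_split/=.
  by apply: ler_sum => i _; exact: gtilde_le_loss.
have tele : M 0%N - \sum_(k < T) @round_error R N (1 - delta) tau T k <= M T.
  have : forall n, (n <= T)%N ->
     M 0%N - \sum_(k < n) @round_error R N (1 - delta) tau T k <= M n.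
    elim=> [_|n IH nT]; first by rewrite big_ord0 subr0.
    by rewrite big_ord_recr/=; have := IH (ltnW nT); have := step n nT; lra.
  by apply.
by rewrite -M0; lra.
Qed.
End Endgame.

(** The constant term cancels, and [beta + delta * T] is the barrier. *)
Lemma LambdaL_diff (R : realType) (delta theta : R) (T N : nat)
    (s s' : 'rV[R]_N) (t t' : R) :
  let B := barrier delta theta T in let tau := Defs.shift delta theta T in
  LambdaL delta theta T s t - LambdaL delta theta T s' t' =
  N%:R^-1 * \sum_(i < N) gtilde (s 0 i + B) (t - tau) -
  N%:R^-1 * \sum_(i < N) gtilde (s' 0 i + B) (t' - tau).
Proof.
have subrBB (a b c : R) : a - c - (b - c) = a - b by ring.
rewrite /LambdaL /fpot subrBB; congr (_ * _ - _ * _).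
  by apply: eq_bigr => i _; rewrite -addrA subrK.
by apply: eq_bigr => i _; rewrite -addrA subrK.
Qed.

(** * Sizes of the shift and of the number of chips in powers of [T] *)

Section ShiftBounds.
Context {R : realType}.
Variables (theta delta : R) (T N : nat).
Hypotheses (theta_gt0 : 0 < theta) (theta_lt : theta < 2 / 3).
Hypotheses (T_gt0 : (0 < T)%N) (delta_ge0 : 0 <= delta) (delta_lt1 : delta < 1).

Let t := T%:R : R.
Let rho : R := t `^ (- (theta / 4)).
Let tau := Defs.shift delta theta T.

Let t_ge1 : 1 <= t. Proof. by rewrite ler1n. Qed.
Let t_gt0 : 0 < t. Proof. exact: lt_le_trans t_ge1. Qed.

Let powt_ge1 x : 0 <= x -> 1 <= t `^ x.
Proof. by move=> x0; have := ler_powR t_ge1 x0; rewrite powRr0. Qed.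

Lemma shift_ge : t `^ (theta / 2) <= tau.
Proof.
have h0 : 0 < 1 - delta by rewrite subr_gt0.
rewrite /tau /Defs.shift /barrier lerBrDl -ler_pdivrMr//.
exact: ceil_ge.
Qed.

Lemma shift_le : tau <= t `^ (theta / 2) + 1.
Proof.
have h0 : 0 < 1 - delta by rewrite subr_gt0.
have d0 := delta_ge0.
rewrite /tau /Defs.shift /barrier -/t; set x := delta * t + _.
have y1 : (Num.ceil (x / (1 - delta)))%:~R <= x / (1 - delta) + 1.
  by have := Num.Theory.ceilB1_lt (x / (1 - delta)); rewrite intrB; lra.
rewrite lerBlDr; apply: le_trans (ler_wpM2r (ltW h0) y1) _.
rewrite (_ : (x / (1 - delta) + 1) * (1 - delta) = x + (1 - delta)); last by field; lra.
rewrite /x; lra.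
Qed.

Lemma shift_ge1 : 1 <= tau.
Proof.
by apply: le_trans shift_ge; rewrite powt_ge1// divr_ge0// ltW.
Qed.

Lemma inv_sqrt_shift_le : (Num.sqrt tau)^-1 <= rho.
Proof.
rewrite /rho powRN lef_pV2 ?posrE ?powR_gt0 ?sqrtr_gt0 ?(lt_le_trans ltr01 shift_ge1)//.
rewrite (_ : t `^ (theta / 4) = Num.sqrt (t `^ (theta / 2))).
  by rewrite ler_sqrt ?shift_ge// (le_trans ler01 shift_ge1).
by rewrite -powR12_sqrt ?powR_ge0// -powRrM; congr (_ `^ _); field.
Qed.

Lemma inv_shift_le : tau^-1 <= rho.
Proof.
rewrite /rho powRN lef_pV2 ?posrE ?powR_gt0 ?(lt_le_trans ltr01 shift_ge1)//.
apply: le_trans shift_ge; rewrite ler_powR//.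
have := theta_gt0; lra.
Qed.

Lemma shift_div_sqrt_le : tau / Num.sqrt t <= 2 * rho.
Proof.
rewrite ler_pdivrMr ?sqrtr_gt0// -mulrA -powR12_sqrt ?(ltW t_gt0)// /rho -powRD; last first.
  by rewrite (gt_eqF t_gt0) implybT.
apply: le_trans shift_le _.
(* Comparing exponents, [theta / 2 <= 1 / 2 - theta / 4] means [theta <= 2 / 3]. *)
have A : t `^ (theta / 2) <= t `^ (- (theta / 4) + 2^-1).
  by rewrite ler_powR//; have := theta_lt; lra.
have : 1 <= t `^ (theta / 2).
  by rewrite powt_ge1// divr_ge0// ltW.
lra.
Qed.

Lemma sqrt_div_chips_le : t `^ ((theta + 2) / 4) <= N%:R ->
  (0 < N)%N /\ Num.sqrt t / N%:R <= rho.
Proof.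
move=> tN; have N0 : 0 < N%:R :> R by apply: lt_le_trans tN; rewrite powR_gt0.
split; first by rewrite -(ltr0n R).
rewrite ler_pdivrMr//; apply: le_trans (ler_wpM2l (powR_ge0 _ _) tN).
rewrite -powRD; last by rewrite (gt_eqF t_gt0) implybT.
by rewrite -powR12_sqrt ?(ltW t_gt0)// (_ : - _ + _ = 2^-1)//; field.
Qed.

Lemma barrier_lattice : exists m : int, barrier delta theta T = m%:~R * (1 - delta).
Proof. by eexists. Qed.
End ShiftBounds.

(** * Assembly of the estimates *)

Theorem theorem10 (R : realType) (gamma theta : R)
    (gamma_ge0 : 0 <= gamma) (theta_gt0 : 0 < theta) (theta_lt : theta < 2 / 3) :
  exists2 err : nat -> R,
    err =O_\oo (fun T : nat => T%:R `^ (- (theta / 4))) &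
    forall (T N : nat) (delta : R),
      (0 < T)%N -> 0 <= delta -> delta < 1 -> gamma = delta ^+ 2 * T%:R / 2 ->
      T%:R `^ ((theta + 2) / 4) <= N%:R ->
      forall P : @history R N -> 'rV[R]_N, player_strategy P ->
      exists A : @history R N -> 'rV[R]_N -> 'rV[R]_N,
        [/\ adversary_strategy delta A,
            associated_with T (@LambdaL R delta theta T N) (err T) A,
            gauss_tail (Num.sqrt gamma) - err T <= final_loss delta T P A
          & forall Q : @history R N -> 'rV[R]_N, player_strategy Q ->
            forall (k : nat) (i : 'I_N), (k < T)%N ->
              (pos_at Q A k 0 i <= - barrier delta theta T ->
                 move_at Q A k 0 i = 0) /\
              (- barrier delta theta T < pos_at Q A k 0 i ->
                 `|move_at Q A k 0 i| = 1 - delta)].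
Proof.
(* In units of [rho], the rounds contribute [4 * sqrt (2 * gamma) + 8], the comparison with the
   final loss 2, and replacing the initial tail argument by [sqrt gamma] 4. *)
pose K := 4 * Num.sqrt (2 * gamma) + 14.
have K14 : 14 <= K by rewrite /K lerDr mulr_ge0// sqrtr_ge0.
exists (fun T => K * T%:R `^ (- (theta / 4))).
  apply/eqOP/bigO_exP; exists K; first lra.
  by near=> T; rewrite normrM (ger0_norm (le_trans _ K14)).
move=> T N delta T0 d0 d1 gE NT P Pst.
set rho := T%:R `^ (- (theta / 4)).
pose tau := Defs.shift delta theta T; pose B := barrier delta theta T.
have tau1 : 1 <= tau := shift_ge1 theta_gt0 T0 d1.
have tau0 : 0 < tau by lra.
have h0 : 0 < 1 - delta by lra.
have h1 : 1 - delta <= 1 by lra.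
have BL : exists m : int, B = m%:~R * (1 - delta) := barrier_lattice _ _ _.
have [N0 sqN] := sqrt_div_chips_le T0 NT.
have rho0 : 0 <= rho by exact: powR_ge0.
have st := inv_sqrt_shift_le theta_gt0 T0 d1.
have it := inv_shift_le theta_gt0 T0 d1.
have sd := shift_div_sqrt_le theta_gt0 theta_lt T0 d0 d1.
rewrite -/rho -/tau in st it sd sqN.
have t0 : 0 < T%:R :> R by rewrite ltr0n.
have sT0 : 0 < Num.sqrt T%:R :> R by rewrite sqrtr_gt0.
have sTT : Num.sqrt T%:R ^+ 2 = T%:R :> R by rewrite sqr_sqrtr// ltW.
have dsT : delta * Num.sqrt T%:R = Num.sqrt (2 * gamma).
  rewrite (_ : 2 * gamma = (delta * Num.sqrt T%:R) ^+ 2).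
    by rewrite sqrtr_sqr ger0_norm// mulr_ge0// ltW.
  by rewrite exprMn sTT gE; field.
have errs : \sum_(k < T) @round_error R N (1 - delta) tau T k <= (K - 6) * rho.
  apply: le_trans (sum_round_error T h0 h1 tau1 N0) _.
  rewrite (_ : 1 - (1 - delta) = delta); last by ring.
  have := ler_wpM2l (sqrtr_ge0 (2 * gamma)) st.
  rewrite -dsT -!mulrA /K -dsT; lra.
exists (adversary (1 - delta) B tau T); split.
- by move=> H p _; apply: rule_admissible; rewrite ?d0.
- split; first by exists (rule (1 - delta) B tau T).
  exists (@round_error R N (1 - delta) tau T).
    by split=> [k|]; [exact: round_error_ge0|lra].
  move=> Q Qst k kT.
  have := @mean_increment R N (1 - delta) B tau T Q h0 h1 tau1 BL k N0.
  rewrite LambdaL_diff -/B -/tau /time_left natrB//.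
  rewrite (_ : - (tau + (T%:R - k.+1%:R)) = k%:R - T%:R + 1 - tau); last first.
    by rewrite -natr1; ring.
  rewrite (_ : - (tau + (T%:R - k.+1%:R) + 1) = k%:R - T%:R - tau) //.
  by rewrite -natr1; ring.
- have := final_loss_ge P N0 (introT andP (conj d0 d1)) tau1 erefl BL.
  suff : gauss_tail (Num.sqrt gamma) - 4 * rho <=
      gauss_tail (B / Num.sqrt (2 * (tau + T%:R))).
    by move: errs st; rewrite -/rho; lra.
  have BE : B = delta * T%:R + tau by rewrite /tau /Defs.shift /B; ring.
  set y := B / _.
  (* Dropping [tau] from the denominator splits [B = delta * T + tau] into a part giving exactly
     [sqrt gamma] and a remainder of at most [2 * rho], which the Lipschitz constant 2 doubles. *)
  have yle : y <= Num.sqrt gamma + tau / Num.sqrt T%:R.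
    have q0 : 0 < Num.sqrt (2 * T%:R) :> R by rewrite sqrtr_gt0 mulr_gt0.
    have qq : Num.sqrt (2 * T%:R) ^+ 2 = 2 * T%:R :> R by rewrite sqr_sqrtr// mulr_ge0// ltW.
    have dT0 : 0 <= delta * T%:R by rewrite mulr_ge0// ltW.
    have -> : Num.sqrt gamma = delta * T%:R / Num.sqrt (2 * T%:R).
      rewrite (_ : gamma = (delta * T%:R / Num.sqrt (2 * T%:R)) ^+ 2).
        by rewrite sqrtr_sqr ger0_norm// divr_ge0// ltW.
      by rewrite expr_div_n qq gE; field; rewrite gt_eqF.
    apply: (@le_trans _ _ (B / Num.sqrt (2 * T%:R))).
      have B0 : 0 <= B by rewrite BE addr_ge0// ltW.
      have tT0 : 0 < 2 * (tau + T%:R) by rewrite mulr_gt0// addr_gt0.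
      have r0 : 0 < Num.sqrt (2 * (tau + T%:R)) by rewrite sqrtr_gt0.
      rewrite /y ler_wpM2l// lef_pV2 ?posrE// ler_sqrt ?(ltW tT0)//.
      by rewrite ler_wpM2l// lerDr ltW.
    rewrite BE mulrDl lerD2l ler_wpM2l ?(ltW tau0)// lef_pV2 ?posrE//.
    by rewrite ler_sqrt; lra.
  have := gauss_tail_diff_ge0 yle.
  have : Num.sqrt gamma <= Num.sqrt gamma + tau / Num.sqrt T%:R.
    by rewrite lerDl divr_ge0// ltW.
  by move/gauss_tail_diff_le; lra.
- move=> Q Qst k i kT; rewrite move_atE; exact: rule_entry (ltW h0).
Unshelve. all: by end_near. Qed.
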